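(* Let $G_B$ be a graph on $m$ vertices whose adjacency matrix $B$ is invertible. Let $k\ge1$ be an integer and denote by $G_B^{k,1}$ the graph constructed from $G_B$ by adding $k$ pendant vertices to each vertex of $G_B$. Then $G_B^{k,1}$ is negatively pseudo-invertible. If there exists an $m\times m$ signature matrix $D_-$ such that $D_-BD_-\le0$ (entrywise), then $G_B^{k,1}$ is also a positively pseudo-invertible graph.
   Context: Graphs are finite, undirected and simple, with symmetric binary adjacency matrix; $G_B$ denotes the graph with adjacency matrix $B$. Adding $k$ pendant vertices to each vertex means that for each vertex $v$ of $G_B$ one adds $k$ new vertices, each adjacent only to $v$. A signature matrix is a diagonal matrix with diagonal entries in $\{+1,-1\}$. $A^\dagger$ denotes the Moore-Penrose pseudo-inverse of $A$. A graph $G_A$ with adjacency matrix $A$ is positively (resp. negatively) pseudo-invertible if there is a signature matrix $D$ such that all entries of $DA^\dagger D$ are nonnegative (resp. nonpositive). *)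

(* Defs.v *)
From mathcomp Require Import all_boot all_order all_algebra.

Set Implicit Arguments.
Unset Strict Implicit.
Unset Printing Implicit Defensive.

Import Order.TTheory GRing.Theory Num.Theory.

Local Open Scope ring_scope.

Record sgraph := SGraph {
  vertex :> finType;
  edge : rel vertex;
  edge_sym : symmetric edge;
  edge_irrefl : irreflexive edge }.

(* The vertices are listed in the order of [enum]. *)
Definition adjmx (R : pzSemiRingType) (G : sgraph) : 'M[R]_#|vertex G| :=
  \matrix_(i, j) (edge (enum_val i) (enum_val j))%:R.

Section Pendant.

Variables (G : sgraph) (k : nat).

(* [inl v] is the original vertex [v]; [inr (v, i)] is the [i]-th pendant
   vertex attached to [v]. *)
Definition pendant_edge (x y : vertex G + vertex G * 'I_k) : bool :=
  match x, y with
  | inl u, inl v => edge u v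
  | inl u, inr (v, _) => u == v
  | inr (u, _), inl v => u == v
  | inr _, inr _ => false
  end.

Fact pendant_edge_sym : symmetric pendant_edge.
Proof. by move=> [u|[u i]] [v|[v j]] //=; rewrite edge_sym. Qed.

Fact pendant_edge_irrefl : irreflexive pendant_edge.
Proof. by move=> [u|[u i]] //=; rewrite edge_irrefl. Qed.

Definition pendant : sgraph := SGraph pendant_edge_sym pendant_edge_irrefl.

End Pendant.

Section PseudoInverse.

Variable R : realFieldType.

(* The Penrose equations. [R] is real, so the conjugate transpose is the
   transpose. *)
Definition is_mppinv m n (A : 'M[R]_(m, n)) (X : 'M[R]_(n, m)) : Prop :=
  [/\ A *m X *m A = A, X *m A *m X = X,
      (A *m X)^T = A *m X & (X *m A)^T = X *m A].

Lemma is_mppinv_uniq m n (A : 'M[R]_(m, n)) (X Y : 'M[R]_(n, m)) :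
  is_mppinv A X -> is_mppinv A Y -> X = Y.
Proof.
move=> [AXA XAX AXt XAt] [AYA YAY AYt YAt].
have AXY : A *m X = A *m Y.
  by rewrite -AXt -{1}AYA -(mulmxA (A *m Y)) trmx_mul AXt AYt mulmxA AXA.
have XAY : X *m A = Y *m A.
  by rewrite -XAt -{1}AYA -(mulmxA A) mulmxA trmx_mul XAt YAt -mulmxA (mulmxA A) AXA.
by rewrite -XAX XAY -mulmxA AXY mulmxA YAY.
Qed.

Definition signature_mx n (D : 'M[R]_n) : Prop :=
  is_diag_mx D /\ forall i, D i i = 1 \/ D i i = -1.

Definition nonneg_mx m n (A : 'M[R]_(m, n)) : Prop := forall i j, 0 <= A i j.

Definition nonpos_mx m n (A : 'M[R]_(m, n)) : Prop := forall i j, A i j <= 0.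

End PseudoInverse.

Definition positively_pseudo_invertible (R : realFieldType) (G : sgraph) : Prop :=
  exists2 X, is_mppinv (adjmx R G) X &
    exists2 D, signature_mx D & nonneg_mx (D *m X *m D).

Definition negatively_pseudo_invertible (R : realFieldType) (G : sgraph) : Prop :=
  exists2 X, is_mppinv (adjmx R G) X &
    exists2 D, signature_mx D & nonpos_mx (D *m X *m D).

(* Main.v *)
(** The adjacency matrix of [G^(k,1)] is [[B, K], [K^T, 0]] with
    [K *m K^T = k%:M], and its pseudo-inverse is
    [[0, K / k], [K^T / k, - (K^T B K) / k^2]]. Conjugating by the signature
    matrix that is [1] on [G] and [-1] on the pendant vertices makes it
    nonpositive; if [D *m B *m D <= 0], conjugating by [D] on [G], extended to
    the pendant vertices by the sign of their neighbour, makes it nonnegative. *)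
Require Import Defs.
From mathcomp Require Import all_boot all_order all_algebra.

Set Implicit Arguments.
Unset Strict Implicit.
Unset Printing Implicit Defensive.

Import Order.TTheory GRing.Theory Num.Theory.

Local Open Scope ring_scope.

Section SignatureMatrices.

Variable R : realFieldType.

Lemma signature_mxP n (D : 'M[R]_n) :
  signature_mx D ->
  exists2 d : 'rV[R]_n, D = diag_mx d & forall i, d 0 i = 1 \/ d 0 i = -1.
Proof.
move=> [/diag_mxP[d ->] Hd]; exists d => // i.
by have := Hd i; rewrite mxE eqxx.
Qed.

Lemma signature_diag_mx n (d : 'rV[R]_n) :
  (forall i, d 0 i = 1 \/ d 0 i = -1) -> signature_mx (diag_mx d).
Proof.
by move=> Hd; split=> [|i]; [exact: diag_mx_is_diag | rewrite mxE eqxx mulr1n].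
Qed.

Lemma signature_mx1 n : signature_mx (1%:M : 'M[R]_n).
Proof.
rewrite -diag_const_mx; apply: signature_diag_mx => i.
by rewrite mxE; left.
Qed.

Lemma signature_mxN n (D : 'M[R]_n) : signature_mx D -> signature_mx (- D).
Proof.
move=> /signature_mxP[d -> Hd]; rewrite -raddfN; apply: signature_diag_mx => i.
by rewrite mxE; case: (Hd i) => ->; rewrite ?opprK; [right | left].
Qed.

Lemma signature_block_mx n1 n2 (D1 : 'M[R]_n1) (D2 : 'M[R]_n2) :
  signature_mx D1 -> signature_mx D2 -> signature_mx (block_mx D1 0 0 D2).
Proof.
move=> /signature_mxP[d1 -> H1] /signature_mxP[d2 -> H2].
rewrite -diag_mx_row; apply: signature_diag_mx => i.
by rewrite mxE; case: split.
Qed.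

Lemma signature_mx_sqr n (D : 'M[R]_n) : signature_mx D -> D *m D = 1%:M.
Proof.
move=> /signature_mxP[d -> Hd]; rewrite mulmx_diag -diag_const_mx.
congr diag_mx; apply/rowP => i; rewrite !mxE.
by case: (Hd i) => ->; rewrite ?mulrNN mulr1.
Qed.

(** Conjugation by a diagonal matrix multiplies entry [(i, j)] by the signs of [i] and [j], so
    pulling the signs back along [f] commutes with reindexing, even if [f] is not injective. *)
Lemma signature_mxsub n p (f : 'I_p -> 'I_n) (E : 'M[R]_n) :
  signature_mx E ->
  exists2 D, signature_mx D &
    forall M, D *m mxsub f f M *m D = mxsub f f (E *m M *m E).
Proof.
move=> /signature_mxP[d -> Hd]; exists (diag_mx (colsub f d)).
  by apply: signature_diag_mx => i; rewrite mxE.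
by move=> M; rewrite !mul_mx_diag !mul_diag_mx; apply/matrixP => i j; rewrite !mxE.
Qed.

End SignatureMatrices.

Lemma nonneg_block_mx (R : realFieldType) m1 m2 n1 n2
    (A : 'M[R]_(m1, n1)) (B : 'M_(m1, n2)) (C : 'M_(m2, n1)) (D : 'M_(m2, n2)) :
  nonneg_mx A -> nonneg_mx B -> nonneg_mx C -> nonneg_mx D ->
  nonneg_mx (block_mx A B C D).
Proof.
move=> hA hB hC hD i j; rewrite !mxE.
by case: split => ?; rewrite mxE; case: split.
Qed.

Section PendantBlocks.

Variables (R : realFieldType) (G : sgraph) (k : nat).

Local Notation n := #|vertex G|.
Local Notation N := #|vertex (pendant G k)|.

(* Every pendant vertex attached to [v] is sent to the same index, the copy of
   [v] in the second block. *)
Definition pendant_block (i : 'I_N) : 'I_(n + n) :=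
  match enum_val i with
  | inl u => lshift n (enum_rank u)
  | inr (u, _) => rshift n (enum_rank u)
  end.

(** Up to the order of the vertices, the blow-up of [[[A, B], [C, D]]] is [[[A, B K],
    [K^T C, K^T D K]]], so that [K] never has to be written. *)
Definition blowup (M : 'M[R]_(n + n)) : 'M[R]_N :=
  mxsub pendant_block pendant_block M.

(** An index of the first block has one preimage under [pendant_block], an index of the second has
    [k]. *)
Lemma sum_pendant_block (F : 'I_(n + n) -> R) :
  \sum_i F (pendant_block i) =
  \sum_(u < n) F (lshift n u) + \sum_(u < n) F (rshift n u) *+ k.
Proof.
(* Summing over vertices instead of their ranks lets the sum split along the sum type. *)
rewrite (reindex_onto enum_rank enum_val) => /= [|i _]; last exact: enum_valK.
under eq_bigl => x do rewrite enum_rankK eqxx.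
under eq_bigr => x _ do rewrite /pendant_block enum_rankK.
rewrite big_sumType /=; congr (_ + _).
  rewrite [RHS](reindex enum_rank) //.
  by apply: onW_bij; exact: enum_rank_bij.
rewrite [RHS](reindex enum_rank) /=; last first.
  by apply: onW_bij; exact: enum_rank_bij.
transitivity (\sum_(u : vertex G) \sum_(i < k) F (rshift n (enum_rank u))).
  rewrite (pair_bigA _ (fun u (_ : 'I_k) => F (rshift n (enum_rank u)))) /=.
  by apply: eq_bigr => -[].
by apply: eq_bigr => u _; rewrite sumr_const card_ord.
Qed.

(* The middle factor counts the vertices of each block index. *)
Lemma mul_blowup (M M' : 'M[R]_(n + n)) :
  blowup M *m blowup M' = blowup (M *m block_mx 1%:M 0 0 k%:R%:M *m M').
Proof.
have -> : M *m block_mx 1%:M 0 0 k%:R%:M =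
    row_mx (lsubmx M) (k%:R *: rsubmx M).
  rewrite -{1}[M]hsubmxK mul_row_block !mulmx0 addr0 add0r.
  by rewrite mulmx1 mul_mx_scalar.
apply/matrixP => i j; rewrite !mxE.
under eq_bigr => l _ do rewrite !mxE.
rewrite (sum_pendant_block
  (fun l => M (pendant_block i) l * M' l (pendant_block j))).
rewrite big_split_ord /=; congr (_ + _); apply: eq_bigr => l _.
  by rewrite row_mxEl !mxE.
by rewrite row_mxEr !mxE -[LHS]mulr_natl mulrA.
Qed.

(** This is where [K *m K^T = k%:M] enters: each factor [k] comes from a sum over pendant
    vertices. *)
Lemma mul_blowup_block (A B C D A' B' C' D' : 'M[R]_n) :
  blowup (block_mx A B C D) *m blowup (block_mx A' B' C' D') =
  blowup (block_mx (A *m A' + k%:R *: (B *m C')) (A *m B' + k%:R *: (B *m D'))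
                   (C *m A' + k%:R *: (D *m C')) (C *m B' + k%:R *: (D *m D'))).
Proof.
rewrite mul_blowup !mulmx_block !mulmx0 !mulmx1 !addr0 !add0r.
by rewrite !mul_mx_scalar !scalemxAl.
Qed.

Lemma tr_blowup_block (A B C D : 'M[R]_n) :
  (blowup (block_mx A B C D))^T = blowup (block_mx A^T C^T B^T D^T).
Proof. by rewrite -tr_block_mx; apply/matrixP => i j; rewrite !mxE. Qed.

Lemma adjmx_pendant :
  adjmx R (pendant G k) = blowup (block_mx (adjmx R G) 1%:M 1%:M 0).
Proof.
apply/matrixP => i j; rewrite mxE [RHS]mxE /pendant_block.
case: (enum_val i) => [u|[u a]]; case: (enum_val j) => [v|[v b]] /=.
- by rewrite block_mxEul mxE !enum_rankK.
- by rewrite block_mxEur mxE (inj_eq enum_rank_inj).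
- by rewrite block_mxEdl mxE (inj_eq enum_rank_inj).
- by rewrite block_mxEdr mxE.
Qed.

Definition pendant_pinv_block : 'M[R]_(n + n) :=
  block_mx 0 k%:R^-1%:M k%:R^-1%:M (- (k%:R ^- 2 *: adjmx R G)).

Lemma pendant_mppinv : (1 <= k)%N ->
  is_mppinv (adjmx R (pendant G k)) (blowup pendant_pinv_block).
Proof.
move=> hk; rewrite adjmx_pendant /pendant_pinv_block; set B := adjmx R G.
have k0 : k%:R != 0 :> R by rewrite pnatr_eq0 -lt0n.
have kk (M : 'M[R]_n) : k%:R *: (k%:R^-1 *: M) = M.
  by rewrite scalerA divff // scale1r.
have kk2 (M : 'M[R]_n) : k%:R *: (k%:R ^- 2 *: M) = k%:R^-1 *: M.
  by rewrite scalerA expr2 invfM mulrA divff // mul1r.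
(* The blow-up of [P] is the orthogonal projection that averages over the pendant vertices at each
   vertex. It is the value of both products: the block [- B / k^2], counted [k] times, cancels
   [B / k]. *)
pose P : 'M[R]_(n + n) := block_mx 1%:M 0 0 k%:R^-1%:M.
have AX : blowup (block_mx B 1%:M 1%:M 0) *m
    blowup (block_mx 0 k%:R^-1%:M k%:R^-1%:M (- (k%:R ^- 2 *: B))) = blowup P.
  rewrite mul_blowup_block !mulmx0 !mul0mx !mul1mx !scaler0 !addr0 !add0r.
  by rewrite mul_mx_scalar scalerN kk2 subrr -[in k%:R *: _]scalemx1 kk.
have XA : blowup (block_mx 0 k%:R^-1%:M k%:R^-1%:M (- (k%:R ^- 2 *: B))) *m
    blowup (block_mx B 1%:M 1%:M 0) = blowup P.
  rewrite mul_blowup_block !mulmx0 !mul0mx !mulmx1 !scaler0 !addr0 !add0r.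
  by rewrite mul_scalar_mx scalerN kk2 subrr -[in k%:R *: _]scalemx1 kk.
have Pt : (blowup P)^T = blowup P.
  by rewrite tr_blowup_block !tr_scalar_mx !trmx0.
split; rewrite ?AX ?XA // mul_blowup_block;
  by rewrite !mulmx0 !mul0mx !mul1mx !scaler0 ?addr0 ?add0r !mul_scalar_mx ?kk.
Qed.

(** The relative sign of [D1] and [D2] decides the off-diagonal blocks, and [D2] alone the last one:
    [D2 = - D1] gives [- 1 / k] off the diagonal, [D2 = D1] gives [1 / k]. *)
Lemma pendant_pinv_signature (D1 D2 : 'M[R]_n) :
  block_mx D1 0 0 D2 *m pendant_pinv_block *m block_mx D1 0 0 D2 =
  block_mx 0 (k%:R^-1 *: (D1 *m D2)) (k%:R^-1 *: (D2 *m D1))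
           (- (k%:R ^- 2 *: (D2 *m adjmx R G *m D2))).
Proof.
rewrite !mulmx_block !mulmx0 !mul0mx !addr0 !add0r !mul_mx_scalar -!scalemxAl.
by rewrite mulmxN mulNmx -scalemxAr -scalemxAl mul0mx.
Qed.

End PendantBlocks.

Theorem proposition6 (R : realFieldType) (G : sgraph) (k : nat)
    (hk : (1 <= k)%N) (hB : adjmx R G \in unitmx) :
  negatively_pseudo_invertible R (pendant G k) /\
  ((exists2 D : 'M[R]_#|vertex G|,
      signature_mx D & nonpos_mx (D *m adjmx R G *m D)) ->
   positively_pseudo_invertible R (pendant G k)).
Proof.
have hX := pendant_mppinv R G hk.
have s1 := signature_mx1 R #|vertex G|.
have h1 m : nonneg_mx (k%:R^-1 *: 1%:M : 'M[R]_m).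
  by move=> i j; rewrite !mxE mulr_ge0 ?invr_ge0 ?ler0n.
have h0 m : nonneg_mx (0 : 'M[R]_m) by move=> i j; rewrite mxE.
split=> [|[D sD hD]]; exists (blowup k (pendant_pinv_block R G k)) => //.
  have [E sE EX] := signature_mxsub (@pendant_block G k)
    (signature_block_mx s1 (signature_mxN s1)).
  exists E => //; rewrite EX pendant_pinv_signature.
  rewrite !mulNmx !mulmxN !mulmx1 !mul1mx opprK !scalerN => i j.
  (* Writing the zero block as [- 0] pulls one minus sign out of the whole block matrix; what is
     left has nonnegative blocks, since adjacency entries are 0 or 1. *)
  rewrite -{1}[0]oppr0 -opp_block_mx mxE [leLHS]mxE oppr_le0.
  apply: nonneg_block_mx => // u v.
  by rewrite !mxE mulr_ge0 ?invr_ge0 ?exprn_ge0 ?ler0n.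
have [E sE EX] := signature_mxsub (@pendant_block G k) (signature_block_mx sD sD).
exists E => //; rewrite EX pendant_pinv_signature signature_mx_sqr // => i j.
rewrite mxE; apply: nonneg_block_mx => // u v.
by rewrite 2!mxE -mulrN mulr_ge0 ?oppr_ge0 // invr_ge0 exprn_ge0 ?ler0n.
Qed.
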